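(* Let $r \in \{5,6\}$ and let $G = C_2^r \oplus C_6$. Then $$\nu(G) = \nu_2(G) = \mathsf d(G) = \mathsf d^*(G) + 1.$$
   Context: All groups are additively written finite abelian groups; $C_m$ denotes a cyclic group of order $m$, and $C_m^r$ the direct sum of $r$ copies of $C_m$. For a finite abelian group $G$ put $G^\bullet = G \setminus \{0\}$. A sequence over $G$ is an element of the free abelian monoid with basis $G$, i.e. a finite unordered list $S = g_1 \cdot \ldots \cdot g_\ell$ of elements of $G$ with repetition allowed; its length is $|S| = \ell$. Its set of subsequence sums is $\Sigma(S) = \{\sum_{i \in I} g_i : \emptyset \ne I \subseteq \{1,\ldots,\ell\}\}$. The sequence $S$ is zero-sum free if $0 \notin \Sigma(S)$. The small Davenport constant $\mathsf d(G)$ is the maximal length of a zero-sum free sequence over $G$. If $G$ is nontrivial and $G \cong C_{n_1} \oplus \ldots \oplus C_{n_s}$ with $1 < n_1 \mid n_2 \mid \ldots \mid n_s$, then $\mathsf d^*(G) = \sum_{i=1}^s (n_i - 1)$. For nontrivial $G$, $\nu(G)$ is the smallest integer $\ell$ such that every zero-sum free sequence $T$ over $G$ with $|T| \ge \ell$ satisfies: there exist a subgroup $H \subsetneq G$ and an element $\alpha \in G \setminus H$ with $G^\bullet \setminus \Sigma(T) \subseteq \alpha + H$. For a prime divisor $p$ of $|G|$, $\nu_p(G)$ is the smallest integer $\ell$ such that every zero-sum free sequence $T$ over $G$ with $|T| \ge \ell$ satisfies: there exist a subgroup $H \subseteq G$ with index $[G:H] = p$ and an element $\alpha \in G \setminus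 H$ with $G^\bullet \setminus \Sigma(T) \subseteq \alpha + H$. In particular $\nu_2(G)$ is the case $p = 2$. *)

(* Defs.v *)
From HB Require Import structures.
From mathcomp Require Import all_boot all_order all_algebra all_fingroup.
From mathcomp Require Import all_solvable.
From mathcomp Require Import boolp.

Set Implicit Arguments.
Unset Strict Implicit.
Unset Printing Implicit Defensive.

Import GRing.Theory.
Local Open Scope ring_scope.

(* Groups are additive: [finZmodType]. The type [{group G}] refers to the     *)
(* finite group structure that MathComp puts on [G] with [+%R] as group law.  *)
(* Sequences over [G] are lists; every notion below is invariant under        *)
(* permutation of the list.                                                   *)

Definition subsums (G : finZmodType) (S : seq G) : {set G} :=
  [set \sum_(i in I) S`_i | I : {set 'I_(size S)} & I != set0].

Definition zero_sum_free (G : finZmodType) (S : seq G) : bool :=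
  0 \notin subsums S.

Lemma zero_sum_free_size (G : finZmodType) (S : seq G) :
  zero_sum_free S -> (size S < #|G|)%N.
Proof.
move=> zfS; pose n := size S.
pose s (k : 'I_n.+1) : G := \sum_(i < n | (i < k)%N) S`_i.
suff s_inj : injective s by rewrite -[(size S).+1]card_ord -(card_codom s_inj) max_card.
suff lt_neq (k l : 'I_n.+1) : (k < l)%N -> s k != s l.
  move=> k l skl; apply: val_inj; case: (ltngtP k l) => // /lt_neq.
    by rewrite skl eqxx.
  by rewrite skl eqxx.
move=> ltkl; apply: contraNneq zfS => skl.
have lkn : (k < n)%N by rewrite (leq_trans ltkl) // -ltnS.
apply/imsetP; exists [set i : 'I_n | (k <= i < l)%N].
  by rewrite !inE; apply/set0Pn; exists (Ordinal lkn); rewrite inE leqnn.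
apply: (addrI (s k)); rewrite addr0 [LHS]skl /s [LHS](bigID (fun i : 'I_n => (i < k)%N)) /=.
congr (_ + _); apply: eq_bigl => i; last by rewrite inE -leqNgt andbC.
by rewrite andb_idl // => /ltn_trans; apply.
Qed.

Lemma ex_zero_sum_free (G : finZmodType) :
  exists n, [exists T : n.-tuple G, zero_sum_free T].
Proof.
exists 0; apply/existsP; exists [tuple]; apply/imsetP=> -[I].
by rewrite !inE => /set0Pn[[]].
Qed.

Lemma zero_sum_free_bound (G : finZmodType) (n : nat) :
  [exists T : n.-tuple G, zero_sum_free T] -> (n <= #|G|)%N.
Proof. by case/existsP=> T /zero_sum_free_size; rewrite size_tuple => /ltnW. Qed.

Definition small_davenport (G : finZmodType) : nat :=
  ex_maxn (ex_zero_sum_free G) (@zero_sum_free_bound G).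

(* [abelian_type] lists the invariant factors n_s, ..., n_1 of a finite       *)
(* abelian group (all greater than 1, each one divisible by the next).        *)
Definition davenport_star (G : finZmodType) : nat :=
  (\sum_(n <- abelian_type [set: G]) (n - 1))%N.

Definition missed (G : finZmodType) (T : seq G) : {set G} :=
  [set~ 0] :\: subsums T.

Definition translate (G : finZmodType) (a : G) (H : {set G}) : {set G} :=
  [set a + h | h in H].

Definition nu_prop (G : finZmodType) (l : nat) : Prop :=
  forall T : seq G, zero_sum_free T -> (l <= size T)%N ->
  exists (H : {group G}) (a : G),
    [/\ H \proper [set: G], a \notin H & missed T \subset translate a H].

Definition nu_p_prop (p : nat) (G : finZmodType) (l : nat) : Prop :=
  forall T : seq G, zero_sum_free T -> (l <= size T)%N ->
  exists (H : {group G}) (a : G),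
    [/\ #|[set: G] : H|%g = p, a \notin H & missed T \subset translate a H].

Lemma ex_nu_prop (G : finZmodType) : exists l, `[< nu_prop G l >].
Proof.
by exists #|G|; apply/asboolP=> T /zero_sum_free_size; rewrite ltnNge => /negP.
Qed.

Lemma ex_nu_p_prop (p : nat) (G : finZmodType) :
  exists l, `[< nu_p_prop p G l >].
Proof.
by exists #|G|; apply/asboolP=> T /zero_sum_free_size; rewrite ltnNge => /negP.
Qed.

Definition nu (G : finZmodType) : nat := ex_minn (ex_nu_prop G).

Definition nu_p (p : nat) (G : finZmodType) : nat := ex_minn (ex_nu_p_prop p G).

(* Main.v *)
Require Import Defs.
From mathcomp Require Import all_boot all_order all_algebra all_fingroup.
From mathcomp Require Import all_solvable.
From mathcomp Require Import boolp zify ring.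

(** Put n = r + 1, so that G is F_2^n (+) C_3 and d*(G) = n + 4. Everything
    reduces to d(G) = n + 5 together with one suitable sequence of length n + 4.

    Upper bound for d(G). Take a sequence of length l = n + 6 <= 13. The
    subsequences whose F_2^n-component sums to 0 form a binary linear code of
    length l and dimension at least 6. If the sequence is zero-sum free, the
    C_3-component gives weights c_i in F_3 such that, on a 6-dimensional subcode
    F_2^6, the function F(v) = sum of the c_i over the support of v is nonzero
    for every v != 0. As F takes values in F_3, this means F^2 = 1 - delta_0. The
    Fourier transform a of F over F_3 is supported on the at most l coordinate
    functionals and 0, hence on at most 14 points, while F^2 = 1 - delta_0 says
    that the autocorrelation sum_x a(x) a(x + mu) is -1 for mu != 0 and 0 for
    mu = 0. Let p and q be the numbers of values 1 and -1 of a. Counting the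
    pairs in the support by their difference first forces p + q = 12, then
    that all values have the same sign, and finally that the 66 pairs of the
    support represent the 63 nonzero vectors in a way that is contradicted by
    the parallelograms in a group of exponent 2 ([sign_function_support],
    [ternary_weights_vanish], [long_sequences_have_zero_sums]).

    Lower bound for d(G). The sequence [long_seq] has length n + 5; the numbers
    of terms in its nonempty subsequences with trivial F_2-part are 4, 5 and 8,
    none of them divisible by 3.

    The two invariants nu. If T is zero-sum free and g != 0 is not a subsum of
    T, then T extended by -g is again zero-sum free; so a sequence of maximal
    length d(G) has every nonzero element as a subsum, and nu(G) <= nu_2(G) <=
    d(G). Conversely [spread_seq] is a zero-sum free sequence of length
    d(G) - 1 whose missed elements have differences generating one of these
    elements, so they lie in no coset a + H with a outside H
    ([mem_of_coset_balance]); hence d(G) <= nu(G). *)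

Set Implicit Arguments.
Unset Strict Implicit.
Unset Printing Implicit Defensive.

Import GRing.Theory.
Local Open Scope ring_scope.

(** * Subsequence sums as a list *)

(** The sums over nonempty subsequences, listed by recursion; with an abstract
    addition the same list can be evaluated on vectors of natural numbers. *)
Fixpoint sums (M : Type) (add : M -> M -> M) (s : seq M) : seq M :=
  if s is x :: s' then x :: sums add s' ++ map (add x) (sums add s') else [::].

Lemma map_sums (M N : Type) (addM : M -> M -> M) (addN : N -> N -> N)
    (h : M -> N) (s : seq M) :
  (forall x y, h (addM x y) = addN (h x) (h y)) ->
  map h (sums addM s) = sums addN (map h s).
Proof.
move=> hD; elim: s => //= x s IHs; rewrite map_cat IHs -map_comp; congr (_ :: _ ++ _).
by rewrite -IHs -map_comp; apply: eq_map => y /=.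
Qed.

Section Subsums.
Variable G : finZmodType.
Implicit Types (S T : seq G) (x y g : G).

Lemma partial_sum_in_sums S (p : pred nat) (k : 'I_(size S)) :
  p k -> \sum_(i < size S | p i) S`_i \in sums +%R S.
Proof.
elim: S p k => [|x S IHS] p k pk /=; first by case: k pk.
rewrite inE mem_cat big_mkcond big_ord_recl -big_mkcond /=.
set s := \sum_(i < size S | _) _.
have [[i pi]|no_p] := pselect (exists i : 'I_(size S), p i.+1).
  have IH : s \in sums +%R S by exact: (IHS (fun j => p j.+1) i).
  case: ifP => _; last by rewrite add0r IH orbT.
  by rewrite map_f ?orbT.
have s0 : s = 0 by apply: big1 => i pi; case: no_p; exists i.
case: ifPn => [_|np0]; first by rewrite s0 addr0 eqxx.
case: no_p; case: k pk => -[|k] ltk pk; first by rewrite pk in np0.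
by exists (Ordinal (ltk : (k < size S)%N)).
Qed.

Lemma sums_are_partial_sums S y :
  y \in sums +%R S ->
  exists2 p : pred nat, exists k : 'I_(size S), p k & y = \sum_(i < size S | p i) S`_i.
Proof.
elim: S y => [|x S IHS] y //=; rewrite inE mem_cat.
have split_sum (p : pred nat) : \sum_(i < (size S).+1 | p i) (x :: S)`_i =
    (if p 0%N then x else 0) + \sum_(i < size S | p i.+1) S`_i.
  by rewrite big_mkcond big_ord_recl -big_mkcond.
case/or3P=> [/eqP->|/IHS[p [k pk] ->]|/mapP[z /IHS[p [k pk] ->] ->]].
- exists (pred1 0%N); first by exists ord0.
  by rewrite split_sum /= big1 ?addr0.
- pose q : pred nat := fun i => if i is j.+1 then p j else false.
  exists q; first by exists (lift ord0 k).
  by rewrite (split_sum q) add0r.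
- pose q : pred nat := fun i => if i is j.+1 then p j else true.
  exists q; first by exists ord0.
  by rewrite (split_sum q).
Qed.

Lemma mem_subsums S y : (y \in subsums S) = (y \in sums +%R S).
Proof.
apply/imsetP/idP => [[I] | /sums_are_partial_sums[p [k pk] ->]].
  rewrite !inE => /set0Pn[k kI] ->.
  pose p (i : nat) := if insub i is Some j then j \in I else false.
  have pE (i : 'I_(size S)) : p i = (i \in I) by rewrite /p valK.
  rewrite -(eq_bigl _ _ pE); apply: (@partial_sum_in_sums _ _ k).
  by rewrite pE.
exists [set i : 'I_(size S) | p i].
  by rewrite !inE; apply/set0Pn; exists k; rewrite inE.
by apply: eq_bigl => i; rewrite inE.
Qed.

Lemma zero_sum_freeE S : zero_sum_free S = (0 \notin sums +%R S).
Proof. by rewrite /zero_sum_free mem_subsums. Qed.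

Lemma zero_sum_free_drop n S : zero_sum_free S -> zero_sum_free (drop n S).
Proof.
rewrite !zero_sum_freeE; elim: n S => [|n IHn] [|x S] //=.
by rewrite inE mem_cat !negb_or => /and3P[_ /IHn].
Qed.

(** A vanishing sum that involves the new term -g would exhibit g as a subsum
    of S. This is why a zero-sum free sequence of maximal length misses
    nothing. *)
Lemma zero_sum_free_opp_missed S g :
  zero_sum_free S -> g \in missed S -> zero_sum_free (- g :: S).
Proof.
rewrite !zero_sum_freeE in_setD in_setC1 mem_subsums => zfS /andP[gS g_neq0].
rewrite /= inE mem_cat !negb_or eq_sym oppr_eq0 g_neq0 zfS /=.
by apply: contra gS => /mapP[h hS /eqP]; rewrite addrC eq_sym subr_eq0 => /eqP <-.
Qed.

End Subsums.

Lemma sums_map_additive (G H : zmodType) (f : {additive G -> H}) (s : seq G) :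
  sums +%R (map f s) = map f (sums +%R s).
Proof. by rewrite (@map_sums _ _ _ +%R) //; apply: raddfD. Qed.

(** * Sign functions on groups of exponent 2 *)

Section Correlation.
Variable V : finZmodType.
Hypothesis V2 : forall x : V, x + x = 0.
Implicit Types (A B : {set V}) (mu x y : V).

(** The number of ways to write mu as b - a with a in A and b in B. *)
Definition corr A B mu : nat := (\sum_(x in A) ((x + mu)%R \in B))%N.

Lemma sum_corr A B : (\sum_mu corr A B mu = #|A| * #|B|)%N.
Proof.
rewrite /corr exchange_big /= -sum_nat_const; apply: eq_bigr => x _.
rewrite (reindex_inj (addrI (- x))) /= -sum1_card [RHS]big_mkcond /=.
by apply: eq_bigr => y _; rewrite addrA addrN add0r; case: (y \in B).
Qed.

Lemma corr0 A B : corr A B 0 = #|A :&: B|.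
Proof.
rewrite /corr -sum1_card; under eq_bigr do rewrite addr0.
rewrite big_mkcond [RHS]big_mkcond; apply: eq_bigr => x _; rewrite inE.
by case: (x \in A); case: (x \in B).
Qed.

Lemma corrC A B mu : corr A B mu = corr B A mu.
Proof.
rewrite /corr big_mkcond [RHS]big_mkcond (reindex_inj (addIr mu)) /=.
apply: eq_bigr => x _; rewrite -addrA V2 addr0.
by case: (x + mu \in A); case: (x \in B).
Qed.

Lemma corr_card A B mu : corr A B mu = #|[set x in A | x + mu \in B]|.
Proof.
rewrite /corr -sum1_card big_mkcond [RHS]big_mkcond.
by apply: eq_bigr => x _; rewrite inE; case: (x \in A); case: (x + mu \in B).
Qed.

Lemma opp_char2 x : - x = x.
Proof. by apply/eqP; rewrite eq_sym -addr_eq0 V2. Qed.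

Lemma addr_eq0_char2 x y : (x + y == 0) = (x == y).
Proof. by rewrite addr_eq0 opp_char2. Qed.

Lemma addr_eq_id x y : (x + y == x) = (y == 0).
Proof. by rewrite -{2}[x]addr0 (inj_eq (addrI x)). Qed.

(** Two disjoint pairs {a, a + mu} and {b, b + mu} with the same difference
    form a parallelogram, whose other sides give two pairs with difference
    a + b. *)
Lemma parallelogram A mu (a b : V) : a \in A -> a + mu \in A ->
  b \in A -> b + mu \in A -> b != a -> b != a + mu -> mu != 0 ->
  (4 <= corr A A (a + b)%R)%N.
Proof.
move=> aA amA bA bmA ba bam mu0; rewrite corr_card.
have abm : a != b + mu by rewrite -subr_eq opp_char2 eq_sym.
have inj4 : uniq [:: a; b; a + mu; b + mu].
  have neq_add x : x != x + mu by rewrite eq_sym addr_eq_id.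
  by rewrite /= !inE !negb_or !neq_add abm bam (inj_eq (addIr mu)) !(eq_sym a b) ba.
rewrite -[4%N]/(size [:: a; b; a + mu; b + mu]) -(card_uniqP inj4).
apply: subset_leq_card; apply/subsetP => x.
have addKab (c d : V) : c + (c + d) = d by rewrite addrA V2 add0r.
rewrite !inE => /or4P[] /eqP->; apply/andP; split=> //.
- by rewrite addKab.
- by rewrite addrC -addrA V2 addr0.
- by rewrite addrACA V2 add0r addrC.
- by rewrite [a + b]addrC addrACA V2 add0r addrC.
Qed.

Lemma F3_cases (c : 'F_3) : [\/ c = 0, c = 1 | c = -1].
Proof.
by case: c => [[|[|[|]]]] // ltc; [constructor 1|constructor 2|constructor 3]; apply: val_inj.
Qed.

Lemma natr_F3 (k m : nat) : (k%:R == m%:R :> 'F_3) = (k == m %[mod 3]).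
Proof. by rewrite -val_eqE /= !val_Fp_nat. Qed.

Lemma sum_corr_ge (E : V -> nat) :
  #|V| = 64%N -> (forall mu, mu != 0 -> (2 <= E mu)%N) ->
  (\sum_mu E mu >= E 0%R + 126)%N.
Proof.
move=> cardV E2; rewrite (bigD1 0) //= leq_add2l.
have -> : 126%N = (\sum_(mu : V | mu != 0%R) 2)%N.
  by rewrite sum_nat_const cardC1 cardV.
exact: leq_sum.
Qed.

(** Each nonzero mu is represented at least twice, and 12 * 11 = 132 exceeds
    2 * 63 = 126 by 6 only. So some mu is represented more than twice, hence at
    least 5 times by the congruence; its parallelograms then make a + b and
    a + b + mu also occur at least 5 times, and the total excess is at least
    9. *)
Lemma no_planar_dozen (S : {set V}) :
  #|V| = 64%N -> #|S| = 12%N ->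
  ~ (forall mu, mu != 0 -> corr S S mu = 2 %[mod 3]).
Proof.
move=> cardV cardS S2.
have ge2 mu : mu != 0 -> (2 <= corr S S mu)%N by move/S2; lia.
have ge5 mu : mu != 0 -> (2 < corr S S mu)%N -> (5 <= corr S S mu)%N by move/S2; lia.
have total : (\sum_mu corr S S mu = 144)%N by rewrite sum_corr cardS.
have corrS0 : corr S S 0 = 12%N by rewrite corr0 setIid.
(* Only 6 representations are left beyond the two that each mu needs. *)
have excess_bound (D : {set V}) (m : nat) : 0 \notin D ->
    (forall mu, mu \in D -> (corr S S mu >= 2 + m)%N) -> (m * #|D| <= 6)%N.
  move=> D0 Dm; pose E mu := (corr S S mu - m * (mu \in D))%N.
  have : (\sum_mu E mu >= E 0%R + 126)%N.
    apply: sum_corr_ge => // mu mu0; rewrite /E.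
    by case: (boolP (mu \in D)) => [/Dm|_]; [lia | rewrite muln0 subn0 ge2].
  suff : (\sum_mu E mu + m * #|D| = 144)%N.
    by rewrite /E (negPf D0) corrS0; lia.
  rewrite -total -sum1_card big_distrr /= [X in (_ + X)%N]big_mkcond -big_split /=.
  apply: eq_bigr => mu _; rewrite /E; case: (boolP (mu \in D)) => [/Dm|_]; lia.
have [/existsP[mu /andP[mu0 mu_gt2]]|] :=
    boolP [exists mu, (mu != 0) && (2 < corr S S mu)%N]; last first.
  rewrite negb_exists => /forallP le2.
  have : (\sum_mu corr S S mu <= 12 + 126)%N.
    rewrite (bigD1 0) //= corrS0 leq_add2l.
    have -> : 126%N = (\sum_(mu : V | mu != 0%R) 2)%N.
      by rewrite sum_nat_const cardC1 cardV.
    by apply: leq_sum => mu mu0; move: (le2 mu); rewrite mu0 -leqNgt.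
  by rewrite total.
pose M := [set x in S | x + mu \in S].
have cardM : (2 < #|M|)%N by rewrite -corr_card.
have /card_gt0P[a] : (0 < #|M|)%N by apply: leq_trans cardM.
rewrite inE => /andP[aS amS].
have /card_gt0P[b] : (0 < #|M :\: [set a; (a + mu)%R]|)%N.
  rewrite cardsD subn_gt0 (leq_ltn_trans _ cardM) //.
  by rewrite (leq_trans (subset_leq_card (subsetIr _ _))) // cards2; case: eqP.
rewrite !inE negb_or => /and3P[/andP[ba bam] bS bmS].
pose D := [set mu; a + b; a + b + mu].
have ab0 : a + b != 0 by rewrite addr_eq0_char2 eq_sym.
have abm0 : a + b != mu.
  by rewrite -addr_eq0_char2 addrAC addr_eq0_char2 eq_sym.
have cardD : #|D| = 3%N.
  have neq : a + b + mu != mu by rewrite [_ + mu]addrC addr_eq_id.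
  rewrite /D setUC cardsU1 cards2 !inE negb_or neq addr_eq_id mu0.
  by rewrite eq_sym abm0.
suff : (3 * #|D| <= 6)%N by rewrite cardD.
apply: excess_bound => [|nu].
  rewrite !inE !negb_or ![0 == _]eq_sym mu0 ab0 /=.
  by rewrite addr_eq0_char2.
rewrite !inE => /orP[/orP[]|] /eqP->; apply: ge5 => //.
- exact: ltnW (parallelogram aS amS bS bmS ba bam mu0).
- by rewrite addr_eq0_char2.
rewrite -addrA; apply: ltnW; apply: (parallelogram aS amS bmS) => //.
- by rewrite -addrA V2 addr0.
- by apply: contra bam => /eqP <-; rewrite -addrA V2 addr0.
by rewrite (inj_eq (addIr mu)).
Qed.

(** With P and Q the sets where a is 1 and -1, the autocorrelation at mu is
    E(mu) = corr P P + corr Q Q + corr P Q modulo 3, since the 2 corr P Q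
    products that equal -1 count as corr P Q. So E(mu) is 2 modulo 3, thus at
    least 2, for each of the 63 nonzero mu; summing over mu, with s = p + q,
    s^2 - p q >= s + 126. The vanishing at 0 gives 3 | s, so s <= 14 leaves
    s = 12 and p q <= 6, whence p q = 0 and a has constant sign on a set of 12
    points. *)
Lemma sign_function_support (a : V -> 'F_3) :
  #|V| = 64%N -> (forall mu, mu != 0 -> \sum_x a x * a (x + mu) = -1) ->
  \sum_x a x * a x = 0 -> (14 < #|[set x | a x != 0%R]|)%N.
Proof.
move=> cardV autocorr energy.
pose P := [set x | a x == 1]; pose Q := [set x | a x == -1].
pose E mu := (corr P P mu + corr Q Q mu + corr P Q mu)%N.
have PQ0 : P :&: Q = set0.
  by apply/setP=> x; rewrite !inE; case: (F3_cases (a x)) => ->.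
have cardS : #|[set x | a x != 0]| = (#|P| + #|Q|)%N.
  rewrite -cardsUI PQ0 cards0 addn0; apply: eq_card => x; rewrite !inE.
  by case: (F3_cases (a x)) => ->.
have sumE mu : \sum_x a x * a (x + mu) = (E mu)%:R.
  have -> : (E mu)%:R = (corr P P mu + corr Q Q mu)%N%:R
                        - (corr P Q mu + corr Q P mu)%N%:R :> 'F_3.
    rewrite [corr Q P mu]corrC /E !natrD.
    have : 3%:R = 0 :> 'F_3 by apply: val_inj.
    set c := (corr P Q mu)%:R => h3; apply/eqP; rewrite -subr_eq0; apply/eqP.
    by rewrite -[RHS](mulr0 c) -h3; ring.
  have corrE A B : (corr A B mu)%:R =
      \sum_x ((x \in A) && (x + mu \in B))%:R :> 'F_3.
    rewrite /corr big_mkcond natr_sum; apply: eq_bigr => x _.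
    by case: (x \in A).
  rewrite !natrD !corrE -!big_split -sumrB /=.
  apply: eq_bigr => x _; rewrite !inE.
  by case: (F3_cases (a x)) => ->; case: (F3_cases (a (x + mu))) => ->; apply: val_inj.
have E2 mu : mu != 0 -> E mu = 2 %[mod 3].
  move/autocorr; rewrite sumE => EN1; apply/eqP; rewrite -natr_F3 EN1.
  by apply/eqP/val_inj.
have E0 : E 0 = (#|P| + #|Q|)%N by rewrite /E !corr0 !setIid PQ0 cards0 addn0.
have dvd3 : (3 %| #|P| + #|Q|)%N.
  move/eqP: energy; under eq_bigr => x _ do rewrite -{2}[x]addr0.
  by rewrite sumE E0 (natr_F3 _ 0).
have sumEE : (\sum_mu E mu = #|P| * #|P| + #|Q| * #|Q| + #|P| * #|Q|)%N.
  by rewrite /E !big_split !sum_corr.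
have ge : (\sum_mu E mu >= E 0%R + 126)%N.
  by apply: sum_corr_ge => // mu /E2; lia.
rewrite cardS ltnNge; apply/negP => le14.
rewrite sumEE E0 in ge.
have [p0|q0] : #|P| = 0%N \/ #|Q| = 0%N.
(* For p, q > 0 (shifted by one below) with p + q = 12 the product is >= 11. *)
- case: #|P| dvd3 le14 ge => [|p]; first by left.
  case: #|Q| => [|q] dvd3 le14 ge; first by right.
  have [s12|s9] : (p + q = 10 \/ p + q <= 7)%N by lia.
    have Dq : q = (10 - p)%N by lia.
    have : (p * q <= 25)%N by nia.
    by nia.
  have : ((p + q) * (p + q) <= 49)%N by apply: (@leq_mul _ _ 7 7).
  by nia.
- have Pset0 : P = set0 by apply: cards0_eq.
  apply: (@no_planar_dozen Q) => // [|mu mu0]; first by move: dvd3 le14 ge; rewrite p0; nia.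
  by move: (E2 _ mu0); rewrite /E Pset0 /corr !big_set0 add0n addn0.
- have Qset0 : Q = set0 by apply: cards0_eq.
  apply: (@no_planar_dozen P) => // [|mu mu0]; first by move: dvd3 le14 ge; rewrite q0; nia.
  by move: (E2 _ mu0); rewrite /E Qset0 (corrC P set0) /corr !big_set0 !addn0.
Qed.
End Correlation.

(** * Fourier analysis on binary codes with ternary weights *)

Section Fourier.
Variable k : nat.
Implicit Types (v : 'rV['F_2]_k) (x y mu : 'cV['F_2]_k).

Definition chi v x : 'F_3 := if (v *m x) 0 0 == 0 then 1 else -1.

Lemma F2_cases (b : 'F_2) : b = 0 \/ b = 1.
Proof. by case: b => [[|[|]]] // ltb; [left|right]; apply: val_inj. Qed.

Lemma chiDr v x y : chi v (x + y) = chi v x * chi v y.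
Proof.
rewrite /chi mulmxDr mxE.
by case: (F2_cases ((v *m x) 0 0)) => ->; case: (F2_cases ((v *m y) 0 0)) => ->;
  apply: val_inj.
Qed.

Lemma chiDl v w x : chi (v + w) x = chi v x * chi w x.
Proof.
rewrite /chi mulmxDl mxE.
by case: (F2_cases ((v *m x) 0 0)) => ->; case: (F2_cases ((w *m x) 0 0)) => ->;
  apply: val_inj.
Qed.

(** Orthogonality of characters; the parity of k makes the order 2 ^ k of the
    group equal to 1 in F_3, so that no normalising factor appears. *)
Lemma sum_chi x : ~~ odd k -> \sum_v chi v x = (x == 0)%:R.
Proof.
move=> k_even; have [->|x0] := eqVneq x 0.
  rewrite (eq_bigr (fun=> 1)) => [|v _]; last by rewrite /chi mulmx0 mxE eqxx.
  rewrite sumr_const card_mx card_Fp // mul1n -(odd_double_half k) (negPf k_even) add0n.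
  rewrite -mul2n expnM; apply/eqP; rewrite (natr_F3 _ 1).
  by rewrite -modnXm exp1n.
have [j xj] : exists j, x j 0 != 0.
  apply/existsP; rewrite -negb_forall; apply: contra x0 => /forallP x0.
  by apply/eqP/matrixP => i j; rewrite !mxE ord1; apply/eqP/x0.
have chi_j : chi (delta_mx 0 j) x = -1.
  by rewrite /chi -rowE mxE (negPf xj).
have : \sum_v chi v x = - \sum_v chi v x.
  rewrite {1}(reindex_inj (addIr (delta_mx 0 j))) /= -sumrN.
  by apply: eq_bigr => v _; rewrite chiDl chi_j mulrN1.
by case: (F3_cases (\sum_v chi v x)) => ->.
Qed.

(** The transform turns the convolution square of a into the pointwise square;
    in exponent 2 convolution and correlation agree. *)
Lemma autocorrelation (a : 'cV['F_2]_k -> 'F_3) mu : ~~ odd k ->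
  \sum_x a x * a (x + mu) = \sum_v (\sum_x a x * chi v x) ^+ 2 * chi v mu.
Proof.
move=> k_even.
transitivity (\sum_x \sum_y a x * a y * \sum_v chi v (x + y + mu)).
  apply: eq_bigr => x _; rewrite (bigD1 (x + mu)) //= sum_chi //.
  have char2 (z : 'cV['F_2]_k) : z + z = 0.
    by apply/matrixP=> i j; rewrite !mxE; case: (F2_cases (z i j)) => ->; apply: val_inj.
  rewrite addrA char2 add0r char2 eqxx mulr1 big1 ?addr0 // => y y_neq.
  by rewrite sum_chi // addrAC addr_eq0_char2 // eq_sym (negPf y_neq) mulr0.
under eq_bigr do under eq_bigr do rewrite big_distrr /=.
under eq_bigr do rewrite exchange_big.
rewrite exchange_big; apply: eq_bigr => v _ /=.
rewrite expr2 big_distrl /= big_distrl /=; apply: eq_bigr => x _.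
rewrite big_distrr /= big_distrl /=; apply: eq_bigr => y _.
by rewrite !chiDr; ring.
Qed.
End Fourier.

(** A code of dimension 6 and length at most 13 cannot have nonzero weight
    modulo 3 at all its nonzero words. The bit of a functional x at v is
    chi v x - 1 in F_3, so the weight function F has a Fourier transform a
    supported on the columns of B and 0, and [sign_function_support] applies to
    it as soon as F vanishes at 0 only. *)
Lemma ternary_weights_vanish (l : nat) (c : 'I_l -> 'F_3) (B : 'M['F_2]_(6, l)) :
  (l <= 13)%N ->
  exists2 v : 'rV_6, v != 0 & \sum_(i | (v *m B) 0 i != 0) c i = 0.
Proof.
move=> le13.
pose F (v : 'rV['F_2]_6) : 'F_3 := \sum_(i | (v *m B) 0 i != 0) c i.
have [/existsP[v /andP[v0 /eqP Fv]]|] := boolP [exists v, (v != 0) && (F v == 0)].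
  by exists v.
rewrite negb_exists => /forallP F_neq0.
pose a (x : 'cV['F_2]_6) : 'F_3 :=
  \sum_(i | col i B == x) c i - (x == 0)%:R * \sum_i c i.
have F_fourier v : \sum_x a x * chi v x = F v.
  have chi0 : chi v 0 = 1 by rewrite /chi mulmx0 mxE eqxx.
  under eq_bigr => x _ do rewrite mulrBl.
  rewrite sumrB [X in _ - X](bigD1 (0 : 'cV_6)) //= eqxx mul1r chi0 mulr1.
  rewrite [X in _ - (_ + X)]big1 => [|x /negPf->]; last by rewrite !mul0r.
  rewrite addr0; have -> : \sum_x (\sum_(i | col i B == x) c i) * chi v x =
      \sum_i c i * chi v (col i B).
    rewrite [RHS](partition_big (fun i => col i B) xpredT) //=.
    by apply: eq_bigr => x _; rewrite big_distrl; apply: eq_bigr => i /eqP->.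
  rewrite -sumrB /F [RHS]big_mkcond; apply: eq_bigr => i _.
  have -> : (v *m B) 0 i = (v *m col i B) 0 0.
    by rewrite !mxE; apply: eq_bigr => j _; rewrite mxE.
  rewrite /chi; case: (F2_cases ((v *m col i B) 0 0)) => -> /=; first by ring.
  by case: (F3_cases (c i)) => ->; apply: val_inj.
have sqF v : F v ^+ 2 = (v != 0)%:R.
  have := F_neq0 v; have [->|v0] := eqVneq v 0.
    by rewrite /F big1 ?expr0n // => i; rewrite mul0mx mxE eqxx.
  by case: (F3_cases (F v)) => -> //= _; apply: val_inj.
have corr_a mu : \sum_x a x * a (x + mu) = (mu == 0)%:R - 1.
  rewrite autocorrelation //; under eq_bigr do rewrite F_fourier sqF.
  rewrite -(sum_chi mu) // [in RHS](bigD1 0) //= [in LHS](bigD1 0) //= eqxx mul0r add0r.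
  rewrite {2}/chi mul0mx mxE eqxx addrAC subrr add0r.
  by apply: eq_bigr => v ->; rewrite mul1r.
exfalso; suff : (14 < #|[set x | a x != 0%R]|)%N.
  apply/negP; rewrite -leqNgt.
  have /subset_leq_card/leq_trans-> // : [set x | a x != 0] \subset
      0 |: [set col i B | i : 'I_l].
    apply/subsetP => x; rewrite !inE; apply: contraR; rewrite negb_or => /andP[x0 xB].
    rewrite /a (negPf x0) mul0r subr0 big_pred0 // => i.
    by apply: contraNF xB => /eqP<-; apply: imset_f.
  rewrite (leq_trans (leq_card_setU _ _)) // cards1 add1n ltnS (leq_trans _ le13) //.
  by rewrite (leq_trans (leq_imset_card _ _)) // card_ord.
apply: sign_function_support => [x||mu mu0|].
- by apply/matrixP=> i j; rewrite !mxE; case: (F2_cases (x i j)) => ->; apply: val_inj.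
- by rewrite card_mx card_Fp.
- by rewrite corr_a (negPf mu0) sub0r.
by under eq_bigr => x _ do rewrite -{2}[x]addr0; rewrite corr_a eqxx subrr.
Qed.

(** * Long sequences have zero sums *)

Lemma sum_Zp_eq0 (n : nat) (I : finType) (P : pred I) (x : I -> 'Z_n) : (1 < n)%N ->
  (n %| \sum_(i | P i) x i)%N -> \sum_(i | P i) x i = 0.
Proof.
move=> n_gt1; rewrite /dvdn => /eqP dvd_n.
under eq_bigr do rewrite -[x _]natr_Zp.
by rewrite -natr_sum -Zp_nat_mod // dvd_n.
Qed.

Lemma dvdn_sum_F2 (l : nat) (w : 'rV['F_2]_l) (m : 'I_l -> nat) :
  \sum_i w 0 i * (m i)%:R = 0 -> (2 %| \sum_(i | w 0%R i != 0%R) m i)%N.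
Proof.
move=> w0; rewrite /dvdn -[X in X == _](@val_Fp_nat 2) // natr_sum.
suff -> : \sum_(i | w 0 i != 0) (m i)%:R = 0 :> 'F_2 by [].
rewrite -[RHS]w0 big_mkcond; apply: eq_bigr => i _.
by case: (F2_cases (w 0 i)) => ->; rewrite ?mul0r ?mul1r ?eqxx ?oner_eq0.
Qed.

(** Split 'Z_6 into its residues modulo 2 and 3. The residues modulo 2 make
    r + 1 linear conditions on the indicator of a subsequence, so the kernel K
    has dimension at least 6; B spans a 6-dimensional part of it, and the
    residues modulo 3 are the weights of this code. *)
Lemma long_sequences_have_zero_sums (r l : nat) (t : 'I_l -> 'rV['Z_2]_r * 'Z_6) :
  (r + 7 <= l <= 13)%N ->
  exists2 I : {set 'I_l}, I != set0 & \sum_(i in I) t i = 0.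
Proof.
case/andP=> lel le13.
pose Xl : 'M['F_2]_(l, r) := \matrix_(i, j) ((t i).1 0 j : nat)%:R.
pose Xr : 'cV['F_2]_l := \col_i ((t i).2 : nat)%:R.
pose K := kermx (row_mx Xl Xr).
have rkK : (6 <= \rank K)%N.
  by rewrite mxrank_ker; have := rank_leq_col (row_mx Xl Xr); lia.
pose B : 'M['F_2]_(6, l) := (pid_mx 6 : 'M_(6, \rank K)) *m row_base K.
have B_free : row_free B.
  by rewrite /row_free mxrankMfree ?row_base_free // rank_pid_mx.
have BX : B *m row_mx Xl Xr = 0.
  apply/sub_kermxP; rewrite -/K; apply: submx_trans (submxMl _ _) _.
  by rewrite eq_row_base.
have [v v0 sum_c] := ternary_weights_vanish (fun i => ((t i).2 : nat)%:R) B le13.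
pose w := v *m B.
have {}sum_c : \sum_(i | w 0 i != 0) ((t i).2 : nat)%:R = 0 :> 'F_3 by [].
have w0 : w != 0 by rewrite mulmx_free_eq0.
have wX : w *m row_mx Xl Xr = 0 by rewrite -mulmxA BX mulmx0.
move: wX; rewrite mul_mx_row -row_mx0 => /eq_row_mx[wXl wXr].
clearbody w.
exists [set i | w 0 i != 0].
  apply/set0Pn; have /existsP[i wi] : [exists i, w 0 i != 0].
    rewrite -negb_forall; apply: contra w0 => /forallP w0.
    by apply/eqP/rowP=> i; rewrite [RHS]mxE; apply/eqP/w0.
  by exists i; rewrite inE.
rewrite (eq_bigl (fun i => w 0 i != 0)) => [|i]; last by rewrite inE.
apply/eqP; rewrite -pair_eqE /pair_eq /= !raddf_sum /=; apply/andP; split; apply/eqP.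
  apply/rowP=> j; rewrite summxE mxE; apply: sum_Zp_eq0 => //; apply: dvdn_sum_F2.
  move/matrixP/(_ 0 j): wXl; rewrite !mxE => wj; rewrite -[RHS]wj.
  by apply: eq_bigr => i _; rewrite mxE.
apply: sum_Zp_eq0 => //; rewrite (@Gauss_dvd 2 3) //; apply/andP; split.
  apply: dvdn_sum_F2; move/matrixP/(_ 0 0): wXr; rewrite !mxE => wj; rewrite -[RHS]wj.
  by apply: eq_bigr => i _; rewrite mxE.
rewrite /dvdn; move/eqP: sum_c; rewrite -natr_sum.
by rewrite (natr_F3 _ 0).
Qed.

(** * The extremal sequences *)

(** Elements of the group are coded by lists of natural numbers, the first one
    standing for the coordinate in 'Z_6 and the others for the coordinates in
    'Z_2; missing entries are 0, so that the codes need not depend on r. *)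
Fixpoint vplus (s t : seq nat) : seq nat :=
  match s, t with
  | x :: s', y :: t' => (x + y)%N :: vplus s' t'
  | [::], _ => t
  | _, [::] => s
  end.

Definition eqv (r : nat) (s t : seq nat) : bool :=
  (nth 0 s 0 == nth 0 t 0 %[mod 6])%N &&
  all (fun i => nth 0 s i.+1 == nth 0 t i.+1 %[mod 2])%N (iota 0 r).

Definition vec (r : nat) (s : seq nat) : 'rV['Z_2]_r * 'Z_6 :=
  (\row_i (nth 0%N s i.+1)%:R, (nth 0%N s 0)%:R).

Lemma nth_vplus s t i : nth 0%N (vplus s t) i = (nth 0 s i + nth 0 t i)%N.
Proof.
elim: s t i => [|x s IHs] [|y t] [|i] //=; rewrite ?nth_nil ?addn0 //.
Qed.

Lemma vecD r s t : vec r (vplus s t) = vec r s + vec r t.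
Proof.
rewrite /vec nth_vplus natrD; congr (_, _).
by apply/rowP=> i; rewrite !mxE nth_vplus natrD.
Qed.

Lemma vec_nil r : vec r [::] = 0.
Proof. by congr (_, _); apply/rowP=> i; rewrite !mxE nth_nil. Qed.

Lemma eq_natr_Zp n (k m : nat) : (1 < n)%N ->
  (k%:R == m%:R :> 'Z_n) = (k == m %[mod n])%N.
Proof. by move=> n_gt1; rewrite -val_eqE /= !val_Zp_nat. Qed.

Lemma eq_vec r s t : (vec r s == vec r t) = eqv r s t.
Proof.
rewrite -pair_eqE /pair_eq /= eq_natr_Zp // andbC; congr (_ && _).
apply/eqP/allP => [/rowP eq_st i | eq_st].
  rewrite mem_iota add0n => ltir; move/eqP: (eq_st (Ordinal ltir)).
  by rewrite !mxE eq_natr_Zp.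
by apply/rowP=> i; rewrite !mxE; apply/eqP; rewrite eq_natr_Zp // eq_st // mem_iota ltn_ord.
Qed.

Lemma sums_vec r (s : seq (seq nat)) :
  sums +%R (map (vec r) s) = map (vec r) (sums vplus s).
Proof. by rewrite (@map_sums _ _ vplus +%R) //; apply: vecD. Qed.

Lemma vec_notin_sums r (s : seq (seq nat)) t :
  all (fun x => ~~ eqv r t x) (sums vplus s) ->
  vec r t \notin sums +%R (map (vec r) s).
Proof.
move/allP=> s_t; rewrite sums_vec; apply/mapP=> -[x /s_t xt].
by move/eqP; rewrite eq_vec (negPf xt).
Qed.

Definition unitv (c i : nat) : seq nat := c :: ncons i 0%N [:: 1%N].
Definition counitv (c i : nat) : seq nat := c :: [seq (j != i : nat) | j <- iota 0 5].
Definition onesv (c : nat) : seq nat := c :: nseq 5 1%N.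

(** Let g = 2 in 'Z_6, of order 3, and s = e_0 + ... + e_4. The ten first terms
    are the e_i + g and s - e_i + g with i < 5; the others are independent of
    them modulo 2 and occur in no zero sum. If the e_i + g with i in A and the
    s - e_i + g with i in B have a sum with trivial 2-part, then A = B when #|B|
    is even, and A is the complement of B when #|B| is odd. The number of terms
    is thus 4, 8 or 5, and the C_3-part is not 0. *)
Definition long_seq (r : nat) : seq (seq nat) :=
  map (unitv 2) (iota 0 5) ++ map (counitv 2) (iota 0 5) ++
  [:: 3%N] :: map (unitv 0) (iota 5 (r - 5)).

(** With u = 3 in 'Z_6, of order 2, the ten first terms are e_i + g and
    e_i + u + g for i < 5. In a sum with trivial 2-part, e_i + g and
    e_i + u + g occur together, for an even number of indices i, which gives 4
    or 8 terms. *)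
Definition spread_seq (r : nat) : seq (seq nat) :=
  map (unitv 2) (iota 0 5) ++ map (unitv 5) (iota 0 5) ++
  map (unitv 0) (iota 5 (r - 5)).

(** With s = e_0 + ... + e_4, a subsum of [spread_seq] with 2-part s contains
    exactly one of e_i + g, e_i + u + g for each i, so its C_3-part is 5 g = 2 g
    and the elements s and s + g are missed. For the 2-part s - e_i, the number
    of terms is 4, or 6 when both terms at i are used, so 2 g is missed. *)
Definition spread_missed : seq (seq nat) :=
  [:: onesv 0, onesv 2 & map (counitv 4) (iota 0 5)].

Lemma long_seq_avoids_0 r : r = 5%N \/ r = 6%N ->
  all (fun x => ~~ eqv r [::] x) (sums vplus (long_seq r)).
Proof. by case=> ->; vm_compute. Qed.

Lemma spread_seq_avoids r : r = 5%N \/ r = 6%N ->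
  all (fun t => all (fun x => ~~ eqv r t x) (sums vplus (spread_seq r)))
    ([::] :: spread_missed).
Proof. by case=> ->; vm_compute. Qed.

Lemma spread_missed_neq0 r : r = 5%N \/ r = 6%N ->
  all (fun t => ~~ eqv r t [::]) spread_missed.
Proof. by case=> ->; vm_compute. Qed.

(** With s and g as above, both sides are 6 s + g: the five vectors s - e_i add up
    to 4 s, and 5 times 2 g is g. *)
Lemma spread_missed_balance r : r = 5%N \/ r = 6%N ->
  eqv r (foldr vplus [::] (onesv 2 :: nseq 5 (onesv 0)))
        (foldr vplus [::] (onesv 0 :: onesv 0 :: map (counitv 4) (iota 0 5))).
Proof. by case=> ->; vm_compute. Qed.

Lemma sum_vec r (s : seq (seq nat)) : \sum_(x <- s) vec r x = vec r (foldr vplus [::] s).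
Proof.
elim: s => [|x s IHs]; first by rewrite big_nil vec_nil.
by rewrite big_cons IHs /= vecD.
Qed.

(** If x0, x1 and the terms of ys lie in a + H, their differences lie in H; the
    balance equation says that x0 = (x1 - x0) + sum of (x0 - y) over ys, so x0
    and then a lie in H. *)
Lemma mem_of_coset_balance (G : finZmodType) (x0 x1 : G) (ys : seq G)
    (H : {group G}) (a : G) :
  \sum_(x <- x1 :: nseq (size ys) x0) x = \sum_(y <- x0 :: x0 :: ys) y ->
  {subset [:: x0, x1 & ys] <= translate a H} -> a \in H.
Proof.
move=> balance sub_aH.
have HD x y : x \in H -> y \in H -> x + y \in H by apply: groupM.
have HN x : x \in H -> - x \in H by move=> Hx; have := groupVr Hx.
have HB x y : x \in translate a H -> y \in translate a H -> x - y \in H.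
  case/imsetP=> h Hh -> /imsetP[k Hk ->]; rewrite opprD addrACA subrr add0r.
  by apply: HD => //; apply: HN.
have x0H : x0 \in translate a H by apply: sub_aH; rewrite inE eqxx.
have diffH : x0 \in H.
  have -> : x0 = (x1 - x0) + \sum_(y <- ys) (x0 - y).
    apply: (addrI (x0 + \sum_(y <- ys) y)); rewrite -addrA [_ + x0]addrC addrA.
    move: balance; rewrite !big_cons -addrA => <-.
    have -> : \sum_(x <- nseq (size ys) x0) x = \sum_(y <- ys) x0.
      by rewrite big_nseq big_const_seq count_predT.
    rewrite addrACA subrKC -big_split; congr (_ + _).
    by apply: eq_bigr => y _; rewrite [RHS]addrC subrK.
  apply: (HD); first by apply: HB => //; apply: sub_aH; rewrite !inE eqxx orbT.
  rewrite big_seq; apply: (big_ind (fun x => x \in H)); [exact: group1 | exact: HD |].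
  by move=> y ys_y; apply: HB => //; apply: sub_aH; rewrite !inE ys_y !orbT.
case/imsetP: x0H => h Hh x0E.
by rewrite -[a](addrK h) -x0E HD // HN.
Qed.

(** * Invariant factors *)

Lemma prod_twos (s : seq nat) (k : nat) :
  {in s, forall n, n = 2} -> (\prod_(n <- s) n = 2 ^ k)%N -> s = nseq k 2%N.
Proof.
move=> s2; have -> : s = nseq (size s) 2%N by apply/all_pred1P/allP=> n /s2->.
rewrite big_nseq iter_muln_1 => /eqP.
by rewrite eqn_exp2l // => /eqP->.
Qed.

(** The largest factor is a multiple of all the others, hence of every prime
    divisor of the product, and so it is 6; the product of the others is a power
    of 2, and 2 is the only divisor of 6 above 1 that is prime to 3. *)
Lemma invariant_factors_C2_C6 (t : seq nat) (r : nat) :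
  sorted [rel m n | n %| m]%N t -> all [pred n | n > 1]%N t ->
  {in t, forall n, n %| 6}%N -> (\prod_(n <- t) n = 2 ^ r * 6)%N ->
  t = 6%N :: nseq r 2%N.
Proof.
case: t => [|m t]; first by rewrite big_nil => _ _ _ /eqP; rewrite eq_sym muln_eq1 andbF.
move=> sorted_mt gt1 dvd6 prod_mt.
have dvd_trans : transitive [rel m n | n %| m]%N.
  by move=> a b c /= ab ca; apply: dvdn_trans ca ab.
have t_dvd_m n : n \in m :: t -> (n %| m)%N.
  rewrite inE => /predU1P[-> //|tn].
  by have /allP/(_ n tn) := order_path_min dvd_trans sorted_mt.
have prime_dvd_m p : prime p -> (p %| 2 ^ r * 6)%N -> (p %| m)%N.
  move=> p_pr; rewrite -prod_mt Euclid_dvd_prod // big_has => /hasP[n nt /= pn].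
  exact: dvdn_trans pn (t_dvd_m n nt).
have m6 : m = 6%N.
  apply/eqP; rewrite eqn_dvd dvd6 ?mem_head //=.
  rewrite (@Gauss_dvd 2 3) // !prime_dvd_m //; first by rewrite dvdn_mull.
  by rewrite dvdn_mull.
move: prod_mt; rewrite m6 big_cons mulnC => /eqP; rewrite eqn_pmul2r // => /eqP prod_t.
congr (_ :: _); apply: prod_twos => // n tn.
have n_gt1 : (1 < n)%N by apply: (allP gt1); rewrite inE tn orbT.
have n_dvd : (n %| 6)%N by rewrite dvd6 // inE tn orbT.
have n_coprime3 : ~~ (3 %| n)%N.
  apply/negP=> dvd3; have : (3 %| 2 ^ r)%N.
    by rewrite -prod_t (big_rem n) //= dvdn_mulr.
  by rewrite Euclid_dvdX.
have := dvdn_leq (isT : 0 < 6)%N n_dvd; move: n_gt1 n_dvd n_coprime3.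
by case: n {tn} => [|[|[|[|[|[|[|]]]]]]].
Qed.

(** * The invariants of the group *)

Section GroupC2C6.
Variables (r : nat) (G : finZmodType).
Variable f : {additive ('rV['Z_2]_r * 'Z_6)%type -> G}.
Hypothesis hf : bijective f.

Lemma card_C2_C6 : #|G| = (2 ^ r * 6)%N.
Proof. by rewrite -(bij_eq_card hf) card_prod card_mx !card_ord mul1n. Qed.

Lemma mul6_eq0 (x : G) : x *+ 6 = 0.
Proof.
have [g _ fK] := hf; rewrite -[x]fK -raddfMn.
suff -> : g x *+ 6 = 0 by rewrite raddf0.
case: (g x) => v z; apply/eqP; rewrite -pair_eqE /pair_eq !raddfMn /=; apply/andP; split.
  apply/eqP/rowP=> i; rewrite mulmxnE !mxE -[v 0 i]natr_Zp -mulrnA.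
  by apply/eqP; rewrite (eq_natr_Zp _ 0) // -[6%N]/(3 * 2)%N mulnA modnMl.
by rewrite -[z]natr_Zp -mulrnA (eq_natr_Zp _ 0) // modnMl.
Qed.

Lemma abelian_type_C2_C6 : abelian_type [set: G] = 6%N :: nseq r 2%N.
Proof.
have abG : abelian [set: G] by apply: FinRing.zmod_abelian.
apply: invariant_factors_C2_C6; rewrite ?abelian_type_dvdn_sorted ?abelian_type_gt1 //.
  case: (abelian_structure abG) => b _ <- n /mapP[x _ ->].
  by rewrite order_dvdn FinRing.zmodXgE mul6_eq0.
case: (abelian_structure abG) => b defG <-.
by rewrite big_map (bigdprod_card defG) cardsT card_C2_C6.
Qed.

Lemma davenport_star_C2_C6 : davenport_star G = (r + 5)%N.
Proof.
by rewrite /davenport_star abelian_type_C2_C6 big_cons big_nseq iter_addn_0 mul1n addnC.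
Qed.

Lemma ex_index2 : exists H : {group G}, #|[set: G] : H|%g = 2%N.
Proof.
have [g gK fK] := hf.
pose H := [set f x | x : 'rV['Z_2]_r * 'Z_6 & ~~ odd x.2].
have memH x : (f x \in H) = ~~ odd x.2 by rewrite mem_imset ?inE //; apply: can_inj gK.
have odd_add (y z : 'Z_6) : odd (y + z)%R = odd y (+) odd z.
  by rewrite /= odd_mod // oddD.
have gH : group_set H.
  apply/group_setP; split; first by rewrite -[1%g](raddf0 f) memH.
  by move=> x y; rewrite -[x]fK -[y]fK FinRing.zmodMgE -raddfD !memH odd_add => /negPf-> /negPf->.
exists (group gH).
pose u := f (0, 1).
have memHu x : (x + u \in H) = (x \notin H).
  by rewrite -[x]fK -raddfD !memH odd_add addbT.
have cardCH : #|~: H| = #|H|.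
  rewrite -[RHS](card_imset _ (addIr u)); apply: eq_card => x; rewrite in_setC.
  apply/idP/imsetP => [Hx | [y Hy ->]]; last by rewrite memHu Hy.
  by exists (x - u); rewrite ?subrK //; rewrite -(subrK u x) memHu negbK in Hx.
have := Lagrange (subsetT (group gH)); rewrite /= cardsT -(cardsC H) cardCH addnn -muln2.
by move/eqP; rewrite eqn_pmul2l ?(cardG_gt0 (group gH)) // => /eqP.
Qed.

Hypothesis hr : r = 5%N \/ r = 6%N.

Lemma zero_sum_free_le (T : seq G) : zero_sum_free T -> (size T <= r + 6)%N.
Proof.
have [g gK fK] := hf.
rewrite leqNgt => zfT; apply/negP=> longT.
pose T' := drop (size T - (r + 7)) T.
have sizeT' : size T' = (r + 7)%N by rewrite size_drop; lia.
have [|I I0 sum_I] := @long_sequences_have_zero_sums r _ (fun i : 'I_(size T') => g T'`_i).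
  by rewrite sizeT'; case: hr; lia.
have /negP := zero_sum_free_drop (size T - (r + 7)) zfT; apply.
apply/imsetP; exists I; rewrite ?inE //.
rewrite -[LHS](raddf0 f) -sum_I raddf_sum.
by apply: eq_bigr => i _; rewrite fK.
Qed.

Lemma mem_missed_image (s : seq (seq nat)) t :
  ~~ eqv r t [::] -> all (fun x => ~~ eqv r t x) (sums vplus s) ->
  f (vec r t) \in missed (map f (map (vec r) s)).
Proof.
move=> t0 /vec_notin_sums t_s; rewrite in_setD in_setC1 mem_subsums.
rewrite (sums_map_additive f) (mem_map (bij_inj hf)) t_s /=.
by rewrite -(raddf0 f) (inj_eq (bij_inj hf)) -(vec_nil r) eq_vec.
Qed.

Lemma zero_sum_free_image (s : seq (seq nat)) :
  all (fun x => ~~ eqv r [::] x) (sums vplus s) ->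
  zero_sum_free (map f (map (vec r) s)).
Proof.
move/vec_notin_sums=> s0; rewrite zero_sum_freeE (sums_map_additive f).
by rewrite -(raddf0 f) (mem_map (bij_inj hf)) -(vec_nil r).
Qed.

Lemma small_davenport_C2_C6 : small_davenport G = (r + 6)%N.
Proof.
rewrite /small_davenport; case: ex_maxnP => d /existsP[T zfT] maxd.
apply/eqP; rewrite eqn_leq; apply/andP; split.
  by have := zero_sum_free_le zfT; rewrite size_tuple.
apply: maxd; apply/existsP.
have sizeS : size (map f (map (vec r) (long_seq r))) == (r + 6)%N.
  by rewrite !size_map !size_cat !size_map /= !size_map !size_iota; case: hr => ->.
by exists (Tuple sizeS); apply/zero_sum_free_image/long_seq_avoids_0.
Qed.

Lemma nu_p_prop_davenport : nu_p_prop 2 G (r + 6).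
Proof.
move=> T zfT longT; have [H idxH] := ex_index2.
have /existsP[a aH] : [exists a, a \notin H].
  rewrite -negb_forall; apply/negP=> /forallP allH.
  have HT : H :=: [set: G] by apply/setP=> x; rewrite inE allH.
  by move: idxH; rewrite HT indexgg.
exists H, a; split=> //; apply/subsetP=> x /(zero_sum_free_opp_missed zfT).
by move/zero_sum_free_le; rewrite /= ltnNge longT.
Qed.

(** [spread_seq] has length r + 5, so a property that holds for all zero-sum free
    sequences of length at least l, and fails for it, forces l >= r + 6. *)
Lemma nu_prop_ge_davenport l : nu_prop G l -> (r + 6 <= l)%N.
Proof.
move=> nu_l; rewrite leqNgt; apply/negP=> lt_l.
have /allP s_avoids := spread_seq_avoids hr.
have zfS := zero_sum_free_image (s_avoids _ (mem_head _ _)).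
have sizeS : (l <= size (map f (map (vec r) (spread_seq r))))%N.
  rewrite !size_map !size_cat !size_map !size_iota; case: hr lt_l => ->; lia.
have [H [a [_ /negP aH sub_aH]]] := nu_l _ zfS sizeS; apply: aH.
apply: (@mem_of_coset_balance _ (f (vec r (onesv 0))) (f (vec r (onesv 2)))
  (map f (map (vec r) (map (counitv 4) (iota 0 5))))).
  have sum_f ws : \sum_(x <- map f (map (vec r) ws)) x = f (vec r (foldr vplus [::] ws)).
    by rewrite !big_map -raddf_sum sum_vec.
  rewrite (sum_f (onesv 2 :: nseq 5 (onesv 0))).
  rewrite (sum_f (onesv 0 :: onesv 0 :: map (counitv 4) (iota 0 5))).
  by congr (f _); apply/eqP; rewrite eq_vec; apply: spread_missed_balance.
move=> x; change (x \in map f (map (vec r) spread_missed) -> x \in translate a H).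
case/mapP=> y /mapP[t ts ->] ->.
apply: (subsetP sub_aH); apply: mem_missed_image; last by apply: s_avoids; rewrite inE ts orbT.
have /allP neq0 := spread_missed_neq0 hr; exact: neq0.
Qed.

Lemma nu_p_prop_nu_prop l : nu_p_prop 2 G l -> nu_prop G l.
Proof.
move=> nu_l T zfT /(nu_l T zfT)[H [a [_ aH sub_aH]]]; exists H, a; split=> //.
by rewrite properT; apply: contraNneq aH => ->; rewrite inE.
Qed.
End GroupC2C6.

Theorem theorem1p3 (r : nat) (hr : r = 5%N \/ r = 6%N) (G : finZmodType)
    (f : {additive ('rV['Z_2]_r * 'Z_6)%type -> G}) (hf : bijective f) :
  [/\ nu G = nu_p 2 G, nu_p 2 G = small_davenport G
    & small_davenport G = (davenport_star G + 1)%N].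
Proof.
have nu2 : nu_p 2 G = (r + 6)%N.
  rewrite /nu_p; case: ex_minnP => l /asboolP nu_l minl.
  apply/eqP; rewrite eqn_leq minl; last exact/asboolP/(nu_p_prop_davenport hf hr).
  exact: (nu_prop_ge_davenport hf hr (nu_p_prop_nu_prop nu_l)).
have nu1 : nu G = (r + 6)%N.
  rewrite /nu; case: ex_minnP => l /asboolP nu_l minl.
  apply/eqP; rewrite eqn_leq (nu_prop_ge_davenport hf hr nu_l) andbT minl //.
  exact/asboolP/nu_p_prop_nu_prop/(nu_p_prop_davenport hf hr).
rewrite nu1 nu2 (small_davenport_C2_C6 hf hr) (davenport_star_C2_C6 hf).
by split=> //; rewrite -addnA.
Qed.
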